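(* Let $\mathscr{E}:\mathbb{R}^N\to[0,\infty]$ be a nonlinear Dirichlet form such that for all $f\in\mathbb{R}^N$ and $a,\lambda\in\mathbb{R}$ $$\mathscr{E}(\lambda f)=\lambda^2\mathscr{E}(f),\qquad \mathscr{E}(f+a\cdot\overrightarrow{1})=\mathscr{E}(f),$$ and let $T=(T_t)_{t\ge0}$ be the associated semigroup. Let $t>0$ and $f\in\mathbb{R}^N$. Suppose that the sequence $T_t^nf$ has an accumulation point at infinity, i.e. there is a component $x_0\in\{1,\dots,N\}$ such that $T_t^nf-T_t^nf(x_0)\cdot\overrightarrow{1}$ has a finite accumulation point in $\mathbb{R}^N$ as $n\to\infty$, and that the associated generator $-\partial\mathscr{E}$ is bounded. Then $T_t^nf$ converges as $n\to\infty$.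
   Context: $\overrightarrow{1}=(1,\dots,1)\in\mathbb{R}^N$; inequalities between vectors are componentwise; $T_t^n$ is the $n$-fold iterate of $T_t$. Let $\mathscr{E}:\mathbb{R}^N\to[0,\infty]$ be a convex and lower semicontinuous functional with dense effective domain. The negative subgradient $-\partial\mathscr{E}$ generates a strongly continuous contraction semigroup $T$: $u(t)=T_tu_0$ satisfies $0\in\frac{du}{dt}(t)+\partial\mathscr{E}(u(t))$ for almost all $t\ge0$, with $u(0)=u_0$. $\mathscr{E}$ is called a (nonlinear) Dirichlet form if $T$ is sub-Markovian, i.e. for all $u,v\in\mathbb{R}^N$ and $t\ge0$: $u\le v$ implies $T_tu\le T_tv$, and $\|T_tu-T_tv\|_\infty\le\|u-v\|_\infty$. The generator being bounded means that $\partial\mathscr{E}$ maps bounded sets to bounded sets. *)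

(* Defs.v *)
From HB Require Import structures.
From mathcomp Require Import all_boot all_order all_algebra.
From mathcomp Require Import all_classical all_reals all_analysis.

Set Implicit Arguments.
Unset Strict Implicit.
Unset Printing Implicit Defensive.

Import Order.TTheory GRing.Theory Num.Theory.
Import numFieldNormedType.Exports.

Local Open Scope classical_set_scope.
Local Open Scope ring_scope.

(* R^N is 'rV[R]_N; the canonical norm `|u| of this
   type is the supremum norm, so the Euclidean structure is given separately. *)

Definition dotp (R : realType) (N : nat) (u v : 'rV[R]_N) : R :=
  \sum_(i < N) u 0 i * v 0 i.

Definition enorm (R : realType) (N : nat) (u : 'rV[R]_N) : R :=
  Num.sqrt (dotp u u).

(* The library's convex_function only covers real-valued functions. Since
   0 * +oo = 0 in \bar R, the cases s = 0 and s = 1 are trivial, as usual. *)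
Definition convex_functional (R : realType) (N : nat)
    (E : 'rV[R]_N -> \bar R) : Prop :=
  forall (u v : 'rV[R]_N) (s : R), 0 <= s <= 1 ->
    (E (s *: u + (1 - s) *: v)%R <= s%:E * E u + (1 - s)%:E * E v)%E.

Definition effective_domain (R : realType) (N : nat)
    (E : 'rV[R]_N -> \bar R) : set 'rV[R]_N :=
  [set u | (E u < +oo)%E].

(* Empty outside the effective domain. *)
Definition subgradient (R : realType) (N : nat) (E : 'rV[R]_N -> \bar R)
    (u : 'rV[R]_N) : set 'rV[R]_N :=
  [set w | effective_domain E u /\
     forall v : 'rV[R]_N, (E u + (dotp w (v - u))%:E <= E v)%E].

Definition absolutely_continuous_on (R : realType) (N : nat) (a b : R)
    (u : R -> 'rV[R]_N) : Prop :=
  forall e : R, 0 < e -> exists2 d : R, 0 < d &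
    forall (n : nat) (x y : 'I_n -> R),
      (forall i, a <= x i /\ x i <= y i /\ y i <= b) ->
      (forall i j, i != j -> y i <= x j \/ y j <= x i) ->
      \sum_(i < n) (y i - x i) < d ->
      \sum_(i < n) `|u (y i) - u (x i)| < e.

(* Strong solution of 0 \in u' + dE(u), u(0) = u0. As always for such
   differential inclusions, u is required to be continuous on [0, +oo[ and
   absolutely continuous on the compact subintervals of ]0, +oo[; the values
   of u at negative times are irrelevant. *)
Definition gradient_flow (R : realType) (N : nat) (E : 'rV[R]_N -> \bar R)
    (u0 : 'rV[R]_N) (u : R -> 'rV[R]_N) : Prop :=
  [/\ u 0 = u0,
      {within `[0, +oo[, continuous u},
      forall a b : R, 0 < a -> a <= b -> absolutely_continuous_on a b u &
      {ae lebesgue_measure, forall s : R, 0 <= s ->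
         derivable u s 1 /\
         exists2 w, subgradient E (u s) w & 'D_1 u s + w = 0} ].

Definition contraction_semigroup (R : realType) (N : nat)
    (T : R -> 'rV[R]_N -> 'rV[R]_N) : Prop :=
  [/\ forall u, T 0 u = u,
      forall s t u, 0 <= s -> 0 <= t -> T (s + t) u = T s (T t u),
      forall u, {within `[0, +oo[, continuous (fun t => T t u)} &
      forall t u v, 0 <= t -> enorm (T t u - T t v) <= enorm (u - v) ].

Definition generated_semigroup (R : realType) (N : nat)
    (E : 'rV[R]_N -> \bar R) (T : R -> 'rV[R]_N -> 'rV[R]_N) : Prop :=
  contraction_semigroup T /\
  forall u0, gradient_flow E u0 (fun t => T t u0).

Definition sub_markovian (R : realType) (N : nat)
    (T : R -> 'rV[R]_N -> 'rV[R]_N) : Prop :=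
  forall (u v : 'rV[R]_N) (t : R), 0 <= t ->
    ((forall i, u 0 i <= v 0 i) -> forall i, T t u 0 i <= T t v 0 i) /\
    `|T t u - T t v| <= `|u - v|.

(* For convex, lower semicontinuous, densely defined E the semigroup generated
   by the negative subgradient exists and is unique for nonnegative times, so
   the quantifier over T only serves to name it. *)
Definition dirichlet_form (R : realType) (N : nat)
    (E : 'rV[R]_N -> \bar R) : Prop :=
  [/\ forall u, (0 <= E u)%E,
      convex_functional E,
      lower_semicontinuous E,
      dense (effective_domain E) &
      forall T, generated_semigroup E T -> sub_markovian T].

Definition bounded_generator (R : realType) (N : nat)
    (E : 'rV[R]_N -> \bar R) : Prop :=
  forall B : set 'rV[R]_N, bounded_set B ->
    bounded_set (\bigcup_(u in B) subgradient E u).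

Definition accumulation_point_at_infinity (R : realType) (N : nat)
    (g : nat -> 'rV[R]_N) : Prop :=
  exists (x0 : 'I_N) (p : 'rV[R]_N),
    cluster ((fun n : nat => g n - const_mx (g n 0 x0)) @ \oo) p.

(* Main.v *)
(* This is Bruck's convergence theorem in finite dimension. Along u(s) = T_s f
   the subgradient inequality gives d/ds |u - p|^2 <= 2 (E p - E u) almost
   everywhere, for every p. Homogeneity makes 0 a minimizer of E, so p = 0 shows
   that u is bounded and that E(u(s)) cannot stay away from 0. A cluster point p
   of u along times at which E(u) tends to 0 is a minimizer, by lower
   semicontinuity; hence |u - p| is nonincreasing, and u converges to p. The
   differential inequality can be integrated because u is Lipschitz: it is
   differentiable at some s0, and the contractions T_s transport the difference
   quotients at s0 to all later times. *)
Require Import Defs.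
From HB Require Import structures.
From mathcomp Require Import all_boot all_order all_algebra.
From mathcomp Require Import all_classical all_reals all_analysis.
From mathcomp Require Import ring lra.

Set Implicit Arguments.
Unset Strict Implicit.
Unset Printing Implicit Defensive.

Import Order.TTheory GRing.Theory Num.Theory.
Import numFieldNormedType.Exports.

Local Open Scope classical_set_scope.
Local Open Scope ring_scope.

(** * Monotonicity of real functions from an almost everywhere derivative bound *)

(** At the supremum of the points where [phi] is at most [phi a], the local condition compares a
    point of that set just to the left with a point to the right, so the supremum can only be
    [b]. *)
Lemma le_of_locally_nonincreasing (R : realType) (phi : R -> R) (a b : R) :
  a <= b ->
  (forall x, a <= x <= b -> exists2 d, 0 < d &
     forall y z, a <= y -> y <= x -> x <= z -> z <= b ->
       x - d < y -> z < x + d -> phi z <= phi y) ->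
  phi b <= phi a.
Proof.
move=> ab loc.
pose A := [set s | a <= s <= b /\ phi s <= phi a].
have Aa : A a by rewrite /A /= lexx ab.
have supA : has_sup A.
  by split; [exists a | exists b => s [/andP[]]].
have abc : a <= sup A <= b.
  apply/andP; split; first by apply: ub_le_sup => //; exact: supA.2.
  by apply: ge_sup; [exists a | move=> s [/andP[]]].
have [d d0 locd] := loc _ abc.
have [y [/andP[ay yb] phiy] dy] := sup_adherent d0 supA.
have yc : y <= sup A by apply: ub_le_sup; [exact: supA.2 | split=> //; exact/andP].
have [ac cb] := andP abc.
pose z := Num.min b (sup A + d / 2).
have zb : z <= b by rewrite ge_min lexx.
have cz : sup A <= z by rewrite le_min cb /=; lra.
have zd : z < sup A + d.
  by rewrite gt_min; apply/orP; right; lra.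
have phiz : phi z <= phi a by rewrite (le_trans (locd y z _ _ _ _ _ _)).
have Az : A z by split => //; rewrite zb (le_trans ac).
have zc : z <= sup A by apply: ub_le_sup => //; exact: supA.2.
move: phiz zc; rewrite /z minElt; case: ltP => // _ _ h.
by exfalso; lra.
Qed.

(** The errors [e * (x - y)] and [e * (z - x)] of the linear approximation at [x] add up to
    [e * (z - y)] because [y] and [z] lie on opposite sides of [x]. *)
Lemma is_derive_straddle (R : realType) (g : R -> R) (x l e : R) :
  is_derive x 1 g l -> 0 < e -> exists2 d, 0 < d &
    forall y z, y <= x -> x <= z -> x - d < y -> z < x + d ->
      g z - g y <= (l + e) * (z - y).
Proof.
move=> [dg gl] e0.
have : h^-1 *: (g (h *: 1 + x) - g x) @[h --> 0^'] --> l by rewrite -gl; exact: dg.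
move/cvgrPdist_lt => /(_ _ e0).
rewrite near_withinE near_nbhs => /nbhs_ballP[d /= d0 hd].
have key h : `|h| < d -> h != 0 -> `|g (h + x) - g x - l * h| <= e * `|h|.
  move=> hd' h0.
  have := hd h; rewrite /ball /= sub0r normrN => /(_ hd' h0) /ltW.
  rewrite [h *: 1]mulr1 -[_ *: _]/(h^-1 * _) => le1.
  have -> : g (h + x) - g x - l * h = - h * (l - h^-1 * (g (h + x) - g x)).
    by field.
  by rewrite normrM normrN mulrC ler_wpM2r.
have key' h : `|h| < d -> `|g (h + x) - g x - l * h| <= e * `|h|.
  have [->|h0] := eqVneq h 0; last by move=> ?; exact: key.
  by rewrite add0r subrr mulr0 subrr normr0 mulr0.
exists d => // y z yx xz dy zd.
have /key' : `|y - x| < d by rewrite ltr_norml; apply/andP; split; lra.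
have /key' : `|z - x| < d by rewrite ltr_norml; apply/andP; split; lra.
rewrite !subrK (ger0_norm (_ : 0 <= z - x)) ?subr_ge0//.
rewrite (ler0_norm (_ : y - x <= 0)) ?subr_le0// !ler_norml.
move=> /andP[_ h1] /andP[h2 _]; nra.
Qed.

(** Off the null set a small linear term beats the slope; on it, the measure of a thin open cover
    does. Both corrections are of order [e] on [[a, b]], and [e] is arbitrary. *)
Lemma lipschitz_ae_nonincreasing (R : realType) (g : R -> R) (a b L d0 : R)
    (Z : set R) :
  a <= b -> 0 <= L -> 0 < d0 ->
  (forall y z, a <= y -> y <= z -> z <= b -> z - y < d0 ->
     g z - g y <= L * (z - y)) ->
  lebesgue_measure.-negligible Z ->
  (forall x, a <= x <= b -> ~ Z x -> exists2 l, is_derive x 1 g l & l <= 0) ->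
  g b <= g a.
Proof.
move=> ab L0 d00 lipg [B [mB B0 ZB]] dg.
suff H (e : R) : 0 < e -> g b <= g a + e * (b - a) + L * e.
  rewrite -subr_le0; apply/ler_addgt0Pr => e e0; rewrite add0r.
  have K0 : 0 < b - a + L + 1 by lra.
  have := H (e / (b - a + L + 1)) (divr_gt0 e0 K0).
  have : e / (b - a + L + 1) * (b - a + L + 1) = e by rewrite divfK// gt_eqF.
  have : 0 < e / (b - a + L + 1) by exact: divr_gt0.
  set q := e / _ => q0 qe; nra.
move=> e0.
have [|O [oO BO OBe]] := lebesgue_regularity_outer mB _ e0.
  by rewrite [X in (X < _)%E](_ : _ = 0%E) ?ltry//.
have mO : measurable O by exact: (measurable_realfun.open_measurable oO).
(* The part of [O] to the left of [s]: nondecreasing, below [e], and growing at unit speed inside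
   [O]. *)
pose m s := fine (lebesgue_measure (O `&` `]-oo, s]%classic)).
have mOe : (lebesgue_measure O < e%:E)%E.
  have mOB : measurable (O `\` B) by exact: measurableD.
  rewrite -(setDUK BO); apply: (le_lt_trans (measureU2 _ mB mOB)).
  by rewrite [X in (X + _)%E](_ : _ = 0%E) ?add0e//.
have mOs s : measurable (O `&` `]-oo, s]%classic) by exact: measurableI.
have lem s : (lebesgue_measure (O `&` `]-oo, s]%classic) < e%:E)%E.
  apply: (le_lt_trans _ mOe); apply: le_measure; rewrite ?inE//; exact: mOs.
have mfin s : lebesgue_measure (O `&` `]-oo, s]%classic) \is a fin_num.
  by rewrite ge0_fin_numE// (lt_trans (lem s))// ltry.
have m_ge0 s : 0 <= m s by exact: fine_ge0.
have m_lt s : m s < e by rewrite -lte_fin fineK.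
have m_mono y z : y <= z -> m y <= m z.
  move=> yz; rewrite fine_le//; apply: le_measure; rewrite ?inE; [exact: mOs..|].
  by apply: setIS => w /=; rewrite !in_itv /= => /le_trans; exact.
have m_len y z : y <= z -> `]y, z]%classic `<=` O -> z - y <= m z - m y.
  move=> yz yzO; rewrite lerBrDl -lee_fin EFinD !fineK//.
  have -> : (z - y)%:E = lebesgue_measure (`]y, z]%classic : set R).
    rewrite lebesgue_measure_itv /= lte_fin; case: ltP => // zy.
    by rewrite (_ : z = y) ?subrr//; apply/eqP; rewrite eq_le yz zy.
  rewrite -measureU; [|exact: mOs|exact: measurable_itv|].
    apply: le_measure; rewrite ?inE; [|exact: mOs|].
      by apply: measurableU; [exact: mOs|exact: measurable_itv].
    move=> w [[Ow] |] /=; rewrite !in_itv /=.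
      by move=> wy; split => //; exact: le_trans yz.
    by move=> /[dup] h /andP[_ wz]; split => //; exact: yzO.
  apply/seteqP; split => w //= [[_]]; rewrite !in_itv /= => wy /andP[yw _].
  by move: (lt_le_trans yw wy); rewrite ltxx.
(* The term L * m absorbs the growth of g on the open cover O of the null set. *)
pose phi s := g s - e * s - L * m s.
suff : phi b <= phi a.
  have := m_lt b; have := m_ge0 a; rewrite /phi; nra.
apply: le_of_locally_nonincreasing => // x axb.
have [Bx|nBx] := pselect (B x); last first.
  have [|l dl l0] := dg x axb; first by move=> /ZB.
  have [d d_gt0 hd] := is_derive_straddle dl e0.
  exists d => // y z ay yx xz zb dy zd.
  have := hd y z yx xz dy zd; have := m_mono y z (le_trans yx xz).
  rewrite /phi; nra.
have /nbhs_ballP[d /= d_gt0 hd] : nbhs x O by apply: open_nbhs_nbhs; split => //; exact: BO.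
(* Half of [d0] on each side of [x] gives [z - y < d0]; staying within [d] keeps []y, z]] inside
   [O]. *)
exists (Num.min d (d0 / 2)); first by rewrite lt_min d_gt0 divr_gt0.
move=> y z ay yx xz zb dy zd.
have h1 : Num.min d (d0 / 2) <= d by rewrite ge_min lexx.
have h2 : Num.min d (d0 / 2) <= d0 / 2 by rewrite ge_min lexx orbT.
have yz := le_trans yx xz.
have : z - y <= m z - m y.
  apply: m_len => // w /=; rewrite in_itv /= => /andP[yw wz].
  by apply: hd; rewrite /ball /= ltr_norml; apply/andP; split; lra.
have : g z - g y <= L * (z - y) by apply: lipg => //; lra.
by rewrite /phi; nra.
Qed.

(** * Supremum norm, Euclidean product and squared distances *)

Lemma normr_coord_le (R : realType) (N : nat) (u : 'rV[R]_N) (i : 'I_N) :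
  `|u 0 i| <= `|u|.
Proof.
rewrite [leRHS]mx_normrE.
exact: (le_bigmax 0 (fun ij : 'I_1 * 'I_N => `|u ij.1 ij.2|) (0, i)).
Qed.

Lemma normr_dotp_le (R : realType) (N : nat) (u v : 'rV[R]_N) :
  `|dotp u v| <= N%:R * (`|u| * `|v|).
Proof.
rewrite (le_trans (ler_norm_sum _ _ _))//.
rewrite (le_trans (ler_sum _ (_ : forall i, true -> _ <= `|u| * `|v|)))//.
  by move=> i _; rewrite normrM ler_pM ?normr_coord_le.
by rewrite sumr_const card_ord mulr_natl.
Qed.

(** A coordinate attaining the supremum norm contributes its square to the sum. *)
Lemma sqr_normr_le_dotp (R : realType) (N : nat) (u : 'rV[R]_N) :
  `|u| ^+ 2 <= dotp u u.
Proof.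
have [->|u0] := eqVneq `|u| 0.
  by rewrite expr0n; apply: sumr_ge0 => i _; rewrite -expr2 sqr_ge0.
have [[k i] uki] := mx_norm_neq0 u0.
rewrite [`|u|]uki /= (ord1 k) -normrX ger0_norm ?sqr_ge0// /dotp (bigD1 i)//= expr2 lerDl.
by apply: sumr_ge0 => j _; rewrite -expr2 sqr_ge0.
Qed.

Lemma sqdistB (R : realType) (N : nat) (p y z : 'rV[R]_N) :
  dotp (z - p) (z - p) - dotp (y - p) (y - p) =
  dotp (z - y) ((z - p) + (y - p)).
Proof.
by rewrite /dotp -sumrB; apply: eq_bigr => i _; rewrite !mxE; ring.
Qed.

Lemma is_derive_sqdist (R : realType) (N : nat) (u : R -> 'rV[R]_N)
    (p : 'rV[R]_N) (s : R) :
  derivable u s 1 ->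
  is_derive s 1 (fun r => dotp (u r - p) (u r - p))
    (2 * dotp ('D_1 u s) (u s - p)).
Proof.
move=> du.
have dui i : is_derive s 1 (fun r => u r 0 i) ('D_1 u s 0 i).
  by rewrite derive_mx// mxE; apply: DeriveDef => //; exact: (derivable_mxP u s 1).1.
have -> : (fun r => dotp (u r - p) (u r - p)) =
    \sum_(i < N) ((fun r => u r 0 i) - cst (p 0 i)) ^+ 2.
  apply/funext => r; rewrite fct_sumE; apply: eq_bigr => i _.
  by rewrite exprfctE !mxE expr2.
apply: is_derive_eq.
rewrite /dotp mulr_sumr; apply: eq_bigr => i _.
rewrite !mxE subr0 [((_ - cst _) : R -> R) s](_ : _ = u s 0 i - p 0 i)//.
by rewrite -[_ *: _]/(_ * _ * _) /=; ring.
Qed.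

(** * Decay of the squared distance along the flow *)

(** Almost everywhere ['D_1 u s = - w] with [w] a subgradient, so half the derivative of the squared
    distance is [dotp w (p - u s)], which is at most [- c]. Hence adding [2 * c * r] still leaves a
    nonincreasing function. *)
Lemma gradient_flow_sqdist_le (R : realType) (N : nat)
    (E : 'rV[R]_N -> \bar R) (u0 : 'rV[R]_N) (u : R -> 'rV[R]_N)
    (p : 'rV[R]_N) (a b c L d : R) :
  gradient_flow E u0 u -> (forall v, (0 <= E v)%E) ->
  0 <= a -> a <= b -> 0 <= c -> 0 <= L -> 0 < d ->
  (forall y z, a <= y -> y <= z -> z - y < d -> `|u z - u y| <= L * (z - y)) ->
  (forall s, a <= s <= b -> (E p + c%:E <= E (u s))%E) ->
  dotp (u b - p) (u b - p) <= dotp (u a - p) (u a - p) - 2 * c * (b - a).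
Proof.
move=> [_ uc _ uE] E0 a0 ab c0 L0 d0 uL Ec.
have [M [_ HM]] : bounded_set (u @` `[a, b]).
  apply: compact_bounded; apply: continuous_compact; last exact: segment_compact.
  apply: continuous_subspaceW uc => x /=; rewrite !in_itv /= => /andP[ax _].
  by rewrite (le_trans a0).
have {}HM s : a <= s <= b -> `|u s| <= `|M| + 1.
  move=> sab; apply: (HM (`|M| + 1)); first by have := ler_norm M; lra.
  by exists s => //; rewrite /= in_itv.
set K := `|M| + 1 in HM.
have K0 : 0 <= K by rewrite addr_ge0.
pose g r := dotp (u r - p) (u r - p) + 2 * c * r.
suff : g b <= g a by rewrite /g; lra.
(* By [sqdistB], with [2 * (K + |p|)] bounding the second factor; [N] is the cost of estimating
   [dotp] by supremum norms. *)
pose L' := N%:R * (L * (2 * (K + `|p|))) + 2 * c.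
have L'0 : 0 <= L' by rewrite /L' addr_ge0 ?mulr_ge0 ?addr_ge0.
apply: (lipschitz_ae_nonincreasing ab L'0 d0 _ uE).
- move=> y z ay yz zb zyd.
  have -> : g z - g y = dotp (u z - u y) (u z - p + (u y - p)) + 2 * c * (z - y).
    by rewrite -sqdistB /g; ring.
  rewrite /L' (mulrDl (N%:R * _)) lerD2r (le_trans (ler_norm _))//.
  rewrite (le_trans (normr_dotp_le _ _))// -mulrA ler_wpM2l//.
  rewrite mulrAC ler_pM//; first exact: uL.
  have hb r : a <= r <= b -> `|u r - p| <= K + `|p|.
    by move=> /HM h; rewrite (le_trans (ler_normB _ _))// lerD2r.
  rewrite (le_trans (ler_normD _ _))// mulr_natl mulr2n lerD// hb//.
    by rewrite zb (le_trans ay).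
  by rewrite ay (le_trans yz).
- move=> s sab /contrapT[|ds [w [Eu sw] /eqP]].
    by rewrite (le_trans a0)//; case/andP: sab.
  rewrite addr_eq0 => /eqP uw.
  exists (2 * dotp ('D_1 u s) (u s - p) + 2 * c).
    apply: is_deriveD; first exact: is_derive_sqdist.
    by rewrite -[X in is_derive _ _ _ X]mulr1; exact: (is_deriveZ (f := id)).
  have Efin : E (u s) \is a fin_num by rewrite ge0_fin_numE.
  have := Ec s sab; have := sw p; have := E0 p.
  have -> : dotp ('D_1 u s) (u s - p) = dotp w (p - u s).
    by rewrite uw; apply: eq_bigr => i _; rewrite !mxE; ring.
  rewrite -(fineK Efin).
  (* The value [+oo] contradicts [Ec] since [E (u s)] is finite; [-oo] contradicts nonnegativity. *)
  case: (E p) => [r||] //=.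
    by rewrite -!EFinD !lee_fin => _ h1 h2; lra.
Qed.

Lemma semigroup_locally_lipschitz (R : realType) (N : nat)
    (E : 'rV[R]_N -> \bar R) (T : R -> 'rV[R]_N -> 'rV[R]_N) (f : 'rV[R]_N) :
  generated_semigroup E T -> sub_markovian T ->
  exists s0 d L : R, [/\ 0 <= s0, 0 < d, 0 <= L &
    forall y z, s0 <= y -> y <= z -> z - y < d ->
      `|T z f - T y f| <= L * (z - y)].
Proof.
move=> [[_ TD _ _] Tflow] Tsub; have [_ _ _ [B [mB B0 ZB]]] := Tflow f.
have [s0 s00 ds0] : exists2 s0, 0 <= s0 & derivable (fun s => T s f) s0 1.
  apply: contrapT => nd.
  (* Without a point of differentiability the null set [B] would contain an interval of length 1. *)
  have IB : `[0, 1]%classic `<=` B.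
    move=> s; rewrite /= in_itv /= => /andP[s_ge0 _]; apply: ZB => /= /(_ s_ge0)[ds _].
    by apply: nd; exists s.
  have : (lebesgue_measure (`[0%R, 1%R]%classic : set R) <= lebesgue_measure B)%E.
    by apply: le_measure; rewrite ?inE//; exact: measurable_itv.
  rewrite [leRHS](_ : _ = 0%E); last exact: B0.
  by rewrite lebesgue_measure_itv /= lte_fin ltr01 sube0 lee_fin ler10.
set D := 'D_1 (fun s => T s f) s0.
have : h^-1 *: (T (h *: 1 + s0) f - T s0 f) @[h --> 0^'] --> D by exact: ds0.
move/cvgrPdist_lt => /(_ _ ltr01).
rewrite near_withinE near_nbhs => /nbhs_ballP[d /= d0 hd].
(* For increments shorter than [d] the difference quotients at [s0] are within 1 of [D]. *)
exists s0, d, (`|D| + 1); split; [exact: s00|exact: d0|by rewrite addr_ge0|].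
move=> y z s0y yz zyd.
have [->|yz'] := eqVneq y z; first by rewrite !subrr normr0 mulr0.
have h0 : 0 < z - y by rewrite subr_gt0 lt_neqAle yz' yz.
have y0 : 0 <= y - s0 by rewrite subr_ge0.
have -> : T z f = T (y - s0) (T (z - y + s0) f).
  by rewrite -TD//; [congr (T _ f); ring|rewrite addr_ge0// ltW].
have -> : T y f = T (y - s0) (T s0 f) by rewrite -TD// subrK.
apply: (le_trans (Tsub _ _ _ y0).2).
have := hd (z - y); rewrite /ball /= sub0r normrN gtr0_norm//.
move=> /(_ zyd (lt0r_neq0 h0)); rewrite [_ *: 1]mulr1 => hq.
set v := T _ f - _ in hq *.
have -> : v = (z - y) *: ((z - y)^-1 *: v).
  by rewrite scalerA mulfV ?scale1r// gt_eqF.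
rewrite normrZ gtr0_norm// mulrC ler_wpM2r ?(ltW h0)//.
set q := _ *: v in hq *.
have -> : q = D - (D - q) by rewrite opprB addrC subrK.
by rewrite (le_trans (ler_normB _ _))// lerD2l ltW.
Qed.

(** * Convergence to a minimizer *)

(** If [E p] exceeded [c], [E] would stay above some [a > c] near [p], yet the sequence comes near
    [p] at indices with [n.+1%:R^-1 < a - c]. *)
Lemma lower_semicontinuous_cluster_le (R : realType) (X : topologicalType)
    (E : X -> \bar R) (x : nat -> X) (p : X) (c : R) :
  lower_semicontinuous E -> cluster (x @ \oo) p ->
  (forall n, (E (x n) < (c + n.+1%:R^-1)%:E)%E) -> (E p <= c%:E)%E.
Proof.
move=> lscE clp Ex; rewrite leNgt; apply/negP => cEp.
have [a ca aEp] : exists2 a, c < a & (a%:E < E p)%E.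
  case: (E p) cEp => [r||]//=; last by move=> _; exists (c + 1); rewrite ?ltry ?ltrDl.
  by rewrite lte_fin => cr; exists ((c + r) / 2); rewrite ?lte_fin ?(midf_lt cr).
have [V Vp VE] := lscE p a aEp.
have xn : (x @ \oo) [set x n | n in [set n | n.+1%:R^-1 < a - c]].
  have : \forall n \near \oo, n.+1%:R^-1 < a - c :> R.
    by apply: near_infty_natSinv_lt (PosNum (_ : 0 < a - c)); rewrite subr_gt0.
  by apply: filterS => n h; exists n.
have [_ [[n /= na <-] /VE]] := clp _ _ xn Vp.
by apply/negP; rewrite -leNgt (le_trans (ltW (Ex n)))// lee_fin -lerBrDl ltW.
Qed.

Theorem theorem8 (R : realType) (N : nat) (E : 'rV[R]_N -> \bar R)
    (T : R -> 'rV[R]_N -> 'rV[R]_N) (t : R) (f : 'rV[R]_N)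
    (E_dirichlet : dirichlet_form E)
    (E_homogeneous : forall (l : R) (g : 'rV[R]_N),
       E (l *: g) = ((l ^+ 2)%:E * E g)%E)
    (E_translation : forall (a : R) (g : 'rV[R]_N),
       E (g + a *: const_mx 1) = E g)
    (T_generated : generated_semigroup E T)
    (t_gt0 : 0 < t)
    (Tf_acc_point :
       accumulation_point_at_infinity (fun n : nat => iter n (T t) f))
    (E_bounded : bounded_generator E) :
  cvgn (fun n : nat => iter n (T t) f).
Proof.
have [E_ge0 _ lscE _ /(_ T T_generated) Tsub] := E_dirichlet.
have [s0 [d [L [s00 d0 L0 TL]]]] := semigroup_locally_lipschitz f T_generated Tsub.
have [[T0 TD _ _] Tflow] := T_generated.
(* The convention that 0 times any extended real is 0 also covers an infinite [E 0]. *)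
have E0 : E 0 = 0%E.
  by have := E_homogeneous 0 0; rewrite scale0r expr0n mul0e.
pose q p s := dotp (T s f - p) (T s f - p).
have decay p c a b : 0 <= c -> s0 <= a -> a <= b ->
    (forall s, a <= s <= b -> (E p + c%:E <= E (T s f))%E) ->
    q p b <= q p a - 2 * c * (b - a).
  move=> c0 s0a ab; apply: (gradient_flow_sqdist_le (L := L) (d := d) (Tflow f)) => //.
    exact: le_trans s0a.
  by move=> y z ay; apply: TL; exact: le_trans ay.
have q_mono p a b : E p = 0%E -> s0 <= a -> a <= b -> q p b <= q p a.
  move=> Ep s0a ab; rewrite -[leRHS]subr0 -(mul0r (b - a)) -(mulr0 2).
  by apply: decay => // s _; rewrite Ep adde0.
(* Otherwise [E] is at least [n.+1%:R^-1] from [s0] on, and the squared norm, dropping at a linear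
   rate, becomes negative. *)
have [s Hs] : {s : nat -> R &
    forall n, s0 <= s n /\ (E (T (s n) f) < (0 + n.+1%:R^-1)%:E)%E}.
  apply: (@choice _ _ (fun n r =>
    s0 <= r /\ (E (T r f) < (0 + n.+1%:R^-1)%:E)%E)) => n; apply: contrapT => nex.
  pose c : R := n.+1%:R^-1; have c0 : 0 < c by rewrite invr_gt0.
  have q0 : 0 <= q 0 s0 by exact: le_trans (sqr_ge0 _) (sqr_normr_le_dotp _).
  (* Then [c * h = q 0 s0 + c], so a drop of [2 * c * h] exceeds the initial value. *)
  pose h := q 0 s0 / c + 1.
  have h0 : 0 < h by rewrite /h ltr_wpDl// divr_ge0// ltW.
  have : q 0 (s0 + h) <= q 0 s0 - 2 * c * (s0 + h - s0).
    apply: decay; [exact: ltW|exact: lexx|by rewrite lerDl ltW|].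
    move=> s /andP[s0s _]; rewrite E0 add0e leNgt; apply/negP => Es.
    by apply: nex; exists s; rewrite add0r.
  have : 0 <= q 0 (s0 + h) by exact: le_trans (sqr_ge0 _) (sqr_normr_le_dotp _).
  have -> : s0 + h - s0 = h by ring.
  have : c * h = q 0 s0 + c by rewrite /h mulrDr mulr1 mulrC divfK// gt_eqF.
  by nra.
pose x n := T (s n) f.
(* The radius avoids a square root: a squared norm at most [q 0 s0] forces a norm at most
   [q 0 s0 + 1]. *)
have [p [_ clp]] : exists p, [set v : 'rV[R]_N | `|v| <= q 0 s0 + 1] p /\ cluster (x @ \oo) p.
  apply: (bounded_closed_compact (A := [set v | `|v| <= q 0 s0 + 1])).
  - exists (q 0 s0 + 1); split; first exact: num_real.
    by move=> M' /= ltM v /= vM; rewrite (le_trans vM) ?ltW.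
  - rewrite (_ : [set v | _] = Num.norm @^-1` [set r | r <= q 0 s0 + 1])//.
    apply: preimage_closed; last exact: closed_le.
    by move=> v _; exact: norm_continuous.
  - suff : \forall n \near \oo, `|x n| <= q 0 s0 + 1 by [].
    apply: nearW => n; have := q_mono 0 s0 (s n) E0 (lexx _) (Hs n).1.
    have := sqr_normr_le_dotp (T (s n) f - 0); rewrite -/(q 0 (s n)) subr0 -/(x n).
    nra.
have Ep : E p = 0%E.
  apply/eqP; rewrite eq_le E_ge0 andbT.
  by apply: (lower_semicontinuous_cluster_le (c := 0) lscE clp) => n; exact: (Hs n).2.
have iterE n : iter n (T t) f = T (n%:R * t) f.
  elim: n => [|n IHn]; first by rewrite mul0r T0.
  by rewrite iterS IHn -TD ?mulr_ge0 ?(ltW t_gt0)// -nat1r mulrDl mul1r.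
apply/cvg_ex; exists p; apply/cvgrPdist_lt => e e0.
(* One time near [p] suffices, as the distance to [p] cannot grow afterwards. With [m = e / (N + 1)]
   the squared distance is at most [N * m ^ 2], below [e ^ 2]. *)
have [_ [[n _ <-]]] : [set x n | n in setT] `&` ball p (e / (N%:R + 1)) !=set0.
  apply: clp.
    suff : \forall n \near \oo, [set x n | n in setT] (x n) by [].
    by apply: nearW => n; exists n.
  by apply: nbhsx_ballx; rewrite divr_gt0 ?ltr_wpDl.
rewrite -ball_normE /= distrC => xn.
near=> k.
rewrite iterE distrC -(ltr_pXn2r (n := 2)) ?nnegrE ?(ltW e0)//.
apply: (le_lt_trans (sqr_normr_le_dotp _)).
have snk : s n <= k%:R * t.
  by rewrite -ler_pdivrMr//; near: k; exact: nbhs_infty_ger.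
apply: (le_lt_trans (q_mono _ _ _ Ep (Hs n).1 snk)).
apply: (le_lt_trans (le_trans (ler_norm _) (normr_dotp_le _ _))).
set w := `|_| in xn *; set m := e / _ in xn.
have w0 : 0 <= w by exact: normr_ge0.
have N0 : 0 <= N%:R :> R by exact: ler0n.
have N10 : 0 < N%:R + 1 :> R by rewrite ltr_wpDl.
have me : m * (N%:R + 1) = e by rewrite /m divfK// gt_eqF.
have m0 : 0 < m by exact: divr_gt0.
have w2 : w * w <= m ^+ 2 by rewrite expr2 ler_pM// ltW.
rewrite -me exprMn mulrC (le_lt_trans (ler_wpM2r N0 w2))// ltr_pM2l ?exprn_gt0//.
nra.
Unshelve. all: by end_near.
Qed.
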